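(* There exists a scattered $T_1$ topological space which is hereditarily meta-Lindelöf and is not $\sigma$-discrete.
   Context: Here spaces are not assumed to be Hausdorff or Tychonoff. A space is scattered if every nonempty subspace of it has an isolated point. A space is meta-Lindelöf if every open cover has an open refinement (an open cover each of whose members is contained in a member of the given cover) which is point countable (each point lies in only countably many members); it is hereditarily meta-Lindelöf if every subspace is meta-Lindelöf. A space is $\sigma$-discrete if it is the union of countably many subspaces each of which is discrete in its relative topology. *)

(* Defs.v *)
From mathcomp Require Import all_boot all_classical.
From mathcomp Require Import topology.
Set Implicit Arguments.
Unset Strict Implicit.
Unset Printing Implicit Defensive.
Local Open Scope classical_set_scope.

(* [isolated A] is the set of points x of A such that {x} is open in the
   relative topology of A. *)
Definition scattered_space (X : topologicalType) : Prop :=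
  forall A : set X, A !=set0 -> isolated A !=set0.

Definition is_open_cover (X : topologicalType) (U : set (set X)) : Prop :=
  U `<=` open /\ \bigcup_(A in U) A = [set: X].

Definition refines (X : Type) (V U : set (set X)) : Prop :=
  forall B, V B -> exists2 A, U A & B `<=` A.

Definition point_countable (X : Type) (V : set (set X)) : Prop :=
  forall x : X, countable [set B | V B /\ B x].

Definition meta_Lindelof (X : topologicalType) : Prop :=
  forall U : set (set X), is_open_cover U ->
    exists V : set (set X),
      [/\ is_open_cover V, refines V U & point_countable V].

(* Below, a set A used as a type is coerced to [set_type A], which carries the
   relative topology. The type [subspace A] would not do: its carrier is all of
   X, with the points outside A made isolated. *)
Definition hereditarily_meta_Lindelof (X : topologicalType) : Prop :=
  forall A : set X, meta_Lindelof A.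

Definition discrete_space (X : topologicalType) : Prop :=
  forall B : set X, open B.

Definition sigma_discrete (X : topologicalType) : Prop :=
  exists D : nat -> set X,
    \bigcup_n D n = [set: X] /\ forall n, discrete_space (D n).

(* Main.v *)
Require Import Defs.
From HB Require Import structures.
From mathcomp Require Import all_boot finmap all_classical.
From mathcomp Require Import wochoice topology.
Set Implicit Arguments.
Unset Strict Implicit.
Unset Printing Implicit Defensive.
Local Open Scope classical_set_scope.

(** Take a strict order [r] all of whose sets of predecessors are countable and
   which has no infinite ascending chain, and declare [U] open when every [x] in
   [U] has all but finitely many of its successors in [U]. Points are closed,
   the sets [{y | y = x \/ r x y}] are open, so the space is scattered, and
   these sets form a point-countable family, so it is hereditarily
   meta-Lindelof. If it is sigma-discrete then [r] is a countable union of
   antichains.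

   To prevent the latter, let the points be pairs (label, countable set of
   earlier points), with labels in an uncountable well-order; going up, the sets
   grow and the labels decrease. Given a colouring by [nat], say that [x] is bad
   for [n] if some countable [C] is contained in the record of no point of
   colour [n] with label above [x]; let [m n] be the least bad label for [n].
   Pick [x] outside the range of [m]. Some point [q] with label [x] records
   witnesses for all the [m n], and, for every [n] for which [x] is good, a point
   of colour [n] with label above [x]. If [x] is good for the colour of [q], then
   [q] is above a point of its own colour; otherwise [q] itself contradicts the
   badness of [m (f q)]. *)

(** * The topology of almost upward closed sets *)

Definition almost_up (T : Type) (r : T -> T -> Prop) : Type := T.

Section AlmostUpTopology.
Variables (T : choiceType) (r : T -> T -> Prop).
Local Notation X := (almost_up r).

Definition almost_up_open : set (set X) :=
  [set U | forall x, U x -> finite_set (r x `\` U)].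

Local Lemma almost_up_openT : almost_up_open setT.
Proof. by move=> x _; rewrite setDT. Qed.

Local Lemma almost_up_openI : setI_closed almost_up_open.
Proof.
move=> U V oU oV x [Ux Vx].
by rewrite setDIr finite_setU; split; [apply: oU|apply: oV].
Qed.

Local Lemma almost_up_open_bigcup (I : Type) (F : I -> set X) :
  (forall i, almost_up_open (F i)) -> almost_up_open (\bigcup_i F i).
Proof.
move=> oF x [i _ Fix]; apply: sub_finite_set (oF i x Fix).
by move=> y [rxy nFy]; split=> // Fiy; apply: nFy; exists i.
Qed.

HB.instance Definition _ := Choice.on X.
HB.instance Definition _ := isOpenTopological.Build X
  almost_up_openT almost_up_openI almost_up_open_bigcup.

Lemma almost_up_openE (U : set X) :
  open U <-> forall x, U x -> finite_set (r x `\` U).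
Proof. by []. Qed.

Lemma almost_up_accessible : accessible_space X.
Proof.
move=> x y xy; exists (~` [set y]); split; last by rewrite setCK inE.
  apply/almost_up_openE => z _; apply: (@sub_finite_set _ _ [set y]) => //.
  by move=> t [_ /contrapT].
by rewrite inE => /= e; rewrite e eqxx in xy.
Qed.

Hypothesis r_trans : forall x y z, r x y -> r y z -> r x z.

Definition up_set (x : X) : set X := [set y | y = x \/ r x y].

Lemma up_set_open (x : X) : open (up_set x).
Proof.
apply/almost_up_openE => y xy; apply: (@sub_finite_set _ _ set0) => //.
move=> z [yz]; apply; right.
by case: xy yz => [->|xy] // yz; apply: r_trans yz.
Qed.

(** A maximal point [x] of [A] is isolated, since [up_set x] meets [A] only in [x]. *)
Lemma almost_up_scattered :
  (forall A : set T, A !=set0 -> exists2 x, A x & forall y, A y -> ~ r x y) ->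
  scattered_space X.
Proof.
move=> rmax A /rmax[x Ax xmax]; exists x; split; first by rewrite inE.
exists (up_set x).
  by apply: open_nbhs_nbhs; split; [apply: up_set_open|left].
rewrite eqEsubset; split=> [y [[->//|xy] Ay]|y ->]; first by have := xmax y Ay.
by split=> //; left.
Qed.

Lemma almost_up_hereditarily_meta_Lindelof :
  (forall y, countable [set x | r x y]) -> hereditarily_meta_Lindelof X.
Proof.
move=> cpre A U [oU covU].
have /choice[O OP] (a : A) : exists B : set A, U B /\ B a.
  have : (\bigcup_(B in U) B) a by rewrite covU.
  by case=> B UB Ba; exists B.
(* A point [b] lies in [V a] only if [a] is [b] or a predecessor of [b], so for countably many
   [a]. *)
pose V (a : A) : set A := O a `&` set_val @^-1` up_set (set_val a).
exists (range V); split.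
- split.
    move=> _ [a _ <-]; apply: openI; first by apply: oU; case: (OP a).
    by exists (up_set (set_val a)) => //; apply: up_set_open.
  rewrite eqEsubset; split=> // a _; exists (V a); first by exists a.
  by split; [case: (OP a)|left].
- by move=> _ [a _ <-]; exists (O a); [case: (OP a)|move=> b []].
- move=> b; pose Q : set X := [set x | x = set_val b \/ r x (set_val b)].
  have cQ : countable Q.
    have -> : Q = [set set_val b] `|` [set x | r x (set_val b)] by [].
    by rewrite -bigcup2E; apply: bigcup_countable => // -[|[|n]] _ //=.
  have cP : countable (set_val @^-1` Q : set A).
    have /countable_injP[g ginj] := cQ; apply/countable_injP.
    exists (g \o set_val) => x y; rewrite !inE => Px Py /= gxy.
    by apply/val_inj/ginj => //; rewrite inE.
  apply: sub_countable cP.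
  apply: card_le_trans (card_image_le V _).
  apply: subset_card_le => B [[a _ <-] [_ ab]]; exists a => //.
  by case: ab => [e|ab]; [left|right].
Qed.

(* In a discrete subspace every point has only finitely many points above it,
   and the number of these strictly decreases along [r]. *)
Lemma sigma_discrete_almost_up_coloring :
  (forall x, ~ r x x) -> sigma_discrete X ->
  exists f : T -> nat, forall x y, r x y -> f x <> f y.
Proof.
move=> rirr [D [covD dD]].
have /choice[i Di] (x : X) : exists n, D n x.
  have : (\bigcup_n D n) x by rewrite covD.
  by case=> n _ Dnx; exists n.
have finD n x : D n x -> finite_set (D n `&` r x).
  move=> Dx.
  have [U oU eU] := dD n [set (exist _ x (mem_set Dx) : D n)].
  have Ux : U x by have : [set SigSub (mem_set Dx)] (SigSub (mem_set Dx)) by [];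
     rewrite -eU.
  apply: sub_finite_set (oU x Ux) => y [Dy rxy]; split=> // Uy.
  have : (set_val @^-1` U) (SigSub (mem_set Dy) : D n) by [].
  rewrite eU => /(congr1 val) /= e.
  by rewrite e in rxy; apply: rirr rxy.
(* The colour codes the piece of [x] together with the number of successors of [x] in that piece. *)
pose k x := #|` fset_set (D (i x) `&` r x)|.
exists (fun x => choice.pickle (i x, k x)) => x y xy /(pcan_inj choice.pickleK)[eqi].
rewrite /k eqi => /eqP; apply/negP; rewrite neq_ltn; apply/orP; right.
have Dy := Di y; have Dx := Di x; rewrite eqi in Dx.
have fx := finD _ _ Dx; have fy := finD _ _ Dy.
apply: fproper_ltn_card; rewrite fproperE; apply/andP; split.
  by rewrite -fset_set_sub // => z [Dz yz]; split=> //; apply: r_trans yz.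
apply/negP; rewrite -fset_set_sub // => sub.
by have [_ /rirr] := sub y (conj Dy xy).
Qed.

End AlmostUpTopology.

(* Only the range of the sequence matters, [None] being ignored: a node is a
   label together with an arbitrary countable set of nodes. *)
Inductive node (W : Type) : Type := Node of W & (nat -> option (node W)).

(** * The order on nodes and its colourings *)

Section Node.
Variables (W : Type) (lt : W -> W -> Prop).

Definition label (p : node W) : W := let: Node x _ := p in x.

Definition record (p : node W) : set (node W) :=
  let: Node _ h := p in [set q | exists n, h n = Some q].

Lemma record_countable (p : node W) : countable (record p).
Proof.
case: p => x h; have /choice[g gP] (q : node W) :
    exists n, record (Node x h) q -> h n = Some q.
  by case: (pselect (record (Node x h) q)) => [[n hn]|nq]; [exists n|exists 0].
apply/countable_injP; exists g => q q'; rewrite !inE => /gP hq /gP hq' e.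
by move: hq; rewrite e hq' => -[].
Qed.

Lemma exists_node (x : W) (C : set (node W)) :
  countable C -> exists p, label p = x /\ record p = C.
Proof.
move=> /countable_injP[g ginj].
have /choice[h hP] n : exists o : option (node W),
    forall q, o = Some q <-> C q /\ g q = n.
  have [[q [Cq gq]]|nq] := pselect (exists q, C q /\ g q = n).
    exists (Some q) => q'; split=> [[<-]//|[Cq' gq']]; congr Some.
    by apply: ginj; rewrite ?inE // gq gq'.
  by exists None => q; split=> // Cq; case: nq; exists q.
exists (Node x h); split=> //; rewrite eqEsubset; split=> q /=.
  by move=> [n /hP[]].
by move=> Cq; exists (g q); apply/hP.
Qed.

Definition below (p q : node W) : Prop :=
  [/\ record q p, record p `<=` record q & lt (label q) (label p)].

Lemma below_countable (q : node W) : countable [set p | below p q].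
Proof.
apply: sub_countable (record_countable q).
by apply: subset_card_le => p [].
Qed.

Hypothesis lt_irr : forall x, ~ lt x x.
Hypothesis lt_trans : forall x y z, lt x y -> lt y z -> lt x z.
Hypothesis lt_min : forall A : set W, A !=set0 ->
  exists2 x, A x & forall y, A y -> y = x \/ lt x y.

Lemma below_irr (p : node W) : ~ below p p.
Proof. by case=> _ _ /lt_irr. Qed.

Lemma below_trans (p q s : node W) : below p q -> below q s -> below p s.
Proof.
move=> [qp pq lqp] [sq qs lsq]; split; first exact: qs.
  exact: subset_trans qs.
exact: lt_trans lqp.
Qed.

(** Labels decrease going up, so a point of least label is maximal. *)
Lemma below_max (A : set (node W)) : A !=set0 ->
  exists2 p, A p & forall q, A q -> ~ below p q.
Proof.
move=> [p0 Ap0]; have [|x [p Ap <-] pmin] := lt_min (A := label @` A).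
  by exists (label p0); exists p0.
exists p => // q Aq [_ _ lqp].
case: (pmin (label q)) => [|e|lpq]; first by exists q.
  by rewrite e in lqp; apply: lt_irr lqp.
exact: lt_irr (lt_trans lpq lqp).
Qed.

Hypothesis W_uncountable : ~ countable [set: W].

Lemma below_uncountable_chromatic (f : node W -> nat) :
  exists p q, below p q /\ f p = f q.
Proof.
pose good n x C := exists p, [/\ C `<=` record p, f p = n & lt x (label p)].
pose bad n := [set x | exists C, countable C /\ ~ good n x C].
(* [m n] pairs the least bad label for [n] with a witness of its badness; it is arbitrary if no
   label is bad. *)
have /choice[m mP] n : exists x : W * set (node W), countable x.2 /\
    (bad n !=set0 -> ~ good n x.1 x.2 /\ forall y, bad n y -> y = x.1 \/ lt x.1 y).
  have [/[dup] bad0 /lt_min[x [C [cC nC]] xmin]|nbad] := pselect (bad n !=set0).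
    by exists (x, C).
  have [x _] : [set: W] !=set0.
    by apply/set0P/negP => /eqP W0; apply: W_uncountable; rewrite W0.
  by exists (x, set0).
pose D := \bigcup_n (m n).2.
have cD : countable D by apply: bigcup_countable => // n _; case: (mP n).
have [x xm] : exists x, forall n, x <> (m n).1.
  apply: contrapT => nx; apply: W_uncountable.
  apply: (@sub_countable _ _ _ (range (fun n => (m n).1))).
    apply: subset_card_le => x _; apply: contrapT => nxm; apply: nx.
    by exists x => n e; apply: nxm; exists n.
  exact: sub_countable (card_image_le _ _) _.
have /choice[c cP] n : exists p, ~ bad n x ->
    [/\ D `<=` record p, f p = n & lt x (label p)].
  have [bx|nbx] := pselect (bad n x).
    by have [p _] := exists_node x (countable0 _); exists p.
  have [p pP] : good n x D by apply: contrapT => nD; apply: nbx; exists D.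
  by exists p.
(* Including [record (c n)] gives the inclusion of records that [below (c n) q] requires. *)
pose C := D `|` \bigcup_n (c n |` record (c n)).
have cC : countable C.
  rewrite /C -bigcup2E; apply: bigcup_countable => // -[|[|i]] _ //=.
  apply: bigcup_countable => // n _.
  rewrite -bigcup2E; apply: bigcup_countable => // -[|[|j]] _ //=.
  exact: record_countable.
have [q [qx qC]] := exists_node x cC.
have [bq|nbq] := pselect (bad (f q) x); last first.
  have [Dc fc lc] := cP _ nbq; exists (c (f q)), q; split=> //.
  split; rewrite ?qC ?qx //.
    by right; exists (f q) => //; left.
  by move=> p pc; right; exists (f q) => //; right.
(* As [x] is not the least bad label, it lies strictly above it; so [q] shows that label good for
   its witness. *)
have [_ []] := mP (f q); first by exists x.
move=> ngood /(_ x bq)[/xm//|lmx]; case: ngood; exists q.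
by split; rewrite ?qx // qC => p mp; left; exists (f q).
Qed.

End Node.

(** * An uncountable well-ordered set of labels *)

Lemma uncountable_set_nat : ~ countable [set: set nat].
Proof.
move=> /countable_injP[g ginj].
pose D := [set n | exists A, g A = n /\ ~ A n].
have nD : ~ D (g D).
  move=> /[dup] DD [A [gA nA]].
  by have e : A = D by [apply: ginj; rewrite ?inE]; rewrite e in nA.
by apply: (nD); exists D.
Qed.

Lemma exists_well_order (T : eqType) : exists lt : T -> T -> Prop,
  [/\ forall x, ~ lt x x, forall x y z, lt x y -> lt y z -> lt x z &
      forall A : set T, A !=set0 ->
        exists2 x, A x & forall y, A y -> y = x \/ lt x y].
Proof.
have [R wo] := well_ordering_principle T.
have wo' : wo_chain R T by move=> A _; apply: wo.
have anti : antisymmetric R.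
  by move=> x y; apply: (wo_chain_antisymmetric wo').
exists (fun x y => R x y /\ x <> y); split.
- by move=> x [].
- move=> x y z [xy nxy] [yz nyz].
  have xz : R x z.
    (* The least of [x], [y], [z] must be [x]: otherwise antisymmetry forces [x = y] or [y = z]. *)
    have [|t [[tin tlb] _]] := wo (mem [:: x; y; z]).
      by exists x; rewrite inE eqxx.
    have [tx ty tz] : [/\ R t x, R t y & R t z].
      by split; apply: tlb; rewrite !inE eqxx ?orbT.
    move: tin; rewrite !inE => /or3P[]/eqP e; rewrite e in tx ty tz => //.
      by case: nxy; apply: anti; rewrite xy.
    by case: nyz; apply: anti; rewrite yz.
  split=> // e; apply: nxy; apply: anti; rewrite xy /=.
  by rewrite e.
- move=> A [a Aa]; have [|x [[xA xlb] _]] := wo (mem A).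
    by exists a; rewrite inE.
  exists x; first by rewrite inE in xA.
  move=> y Ay; have [->|nyx] := pselect (y = x); [by left|right].
  by split; [apply: xlb; rewrite inE|move=> e; apply: nyx].
Qed.

HB.instance Definition _ (W : Type) := gen_eqMixin (node W).
HB.instance Definition _ (W : Type) := gen_choiceMixin (node W).

Theorem mainTheorem9 :
  exists X : topologicalType,
    [/\ scattered_space X,
        accessible_space X,
        hereditarily_meta_Lindelof X
      & ~ sigma_discrete X].
Proof.
have [lt [irr trans lt_min]] := exists_well_order (set nat).
have btrans := below_trans trans.
exists (almost_up (below lt)); split.
- exact: (almost_up_scattered btrans (below_max irr trans lt_min)).
- exact: almost_up_accessible.
- exact: (almost_up_hereditarily_meta_Lindelof btrans (below_countable lt)).
- move=> /(sigma_discrete_almost_up_coloring btrans (below_irr irr))[f fP].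
  have [p [q [pq /(fP _ _ pq)]]] :=
    below_uncountable_chromatic lt_min uncountable_set_nat f.
  exact.
Qed.
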